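(* For all integers $n,d>0$ one has $UCY(n,d)=CY(n,d)$, where $UCY(n,d)$ is the number of Young diagrams uniformly coloured in $d$ colours with $n$ boxes of each colour (hence $nd$ boxes), and $CY(n,d)$ is the number of ordered collections $(\Delta_1,\dots,\Delta_d)$ of $d$ Young diagrams with $\sum_{k=1}^d|\Delta_k|=n$.
   Context: A Young diagram is a finite subset $\Delta\subset\mathbb{Z}_{\ge0}^2$ (its elements are called boxes) such that $(p,q)\in\Delta$, $0\le p'\le p$, $0\le q'\le q$ imply $(p',q')\in\Delta$; the empty diagram is allowed. $|\Delta|$ is the number of boxes. $\Delta$ is uniformly coloured in $d$ colours if $n_i(\Delta)=\#\{(p,q)\in\Delta\mid p-q\equiv i\pmod d\}$ (the number of boxes of colour $i$), $0\le i\le d-1$, does not depend on $i$. *)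

(* Defs.v *)
From mathcomp Require Import all_boot all_order all_algebra.
From mathcomp Require Import finmap.
From mathcomp Require Import boolp classical_sets functions cardinality.

Set Implicit Arguments.
Unset Strict Implicit.
Unset Printing Implicit Defensive.

Local Open Scope fset_scope.
Local Open Scope classical_set_scope.

Definition young_diagram (D : {fset nat * nat}) : Prop :=
  forall p q p' q' : nat,
    (p, q) \in D -> (p' <= p)%N -> (q' <= q)%N -> (p', q') \in D.

Definition ncolor (d i : nat) (D : {fset nat * nat}) : nat :=
  #|` [fset b in D | (b.1%:Z - b.2%:Z == i%:Z %[mod d%:Z])%Z]|.

Definition uniformly_coloured (d : nat) (D : {fset nat * nat}) : Prop :=
  forall i j : 'I_d, ncolor d i D = ncolor d j D.

Definition UCY_set (n d : nat) : set {fset nat * nat} :=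
  [set D | [/\ young_diagram D, uniformly_coloured d D
             & forall i : 'I_d, ncolor d i D = n]].

Definition CY_set (n d : nat) : set (d.-tuple {fset nat * nat}) :=
  [set t | (forall k : 'I_d, young_diagram (tnth t k)) /\
           (\sum_(k < d) #|` tnth t k| = n)%N].

(* [fset_set] is [fset0] on infinite sets; [UCY_set_finite] and
   [CY_set_finite] below show that the two cardinals are genuine. *)
Definition UCY (n d : nat) : nat := #|` fset_set (UCY_set n d)|.

Definition CY (n d : nat) : nat := #|` fset_set (@CY_set n d)|.

Lemma card_ncolor (d : nat) (D : {fset nat * nat}) :
  (0 < d)%N -> #|` D| = (\sum_(i < d) ncolor d i D)%N.
Proof.
move=> d0.
pose c (b : nat * nat) : int := modz (b.1%:Z - b.2%:Z)%R d%:Z%R.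
have c0 b : (0 <= c b)%R by apply: modz_ge0; case: d d0 @c.
have cd b : (`|c b|%N < d)%N.
  have := @ltz_pmod (b.1%:Z - b.2%:Z)%R d%:Z%R d0.
  by rewrite -/(c b) -[X in (X < _)%R](gez0_abs (c0 b)).
have colE (i : 'I_d) b :
    (b.1%:Z - b.2%:Z == i%:Z %[mod d%:Z])%Z = (Ordinal (cd b) == i).
  rewrite -/(c b) (modz_small (m := i%:Z%R)); last by rewrite /= ltz_nat ltn_ord.
  by rewrite -[LHS](congr1 (eq_op^~ _) (gez0_abs (c0 b))).
have nE (i : 'I_d) :
    ncolor d i D = (\sum_(b <- D) if Ordinal (cd b) == i then 1 else 0)%N.
  rewrite /ncolor card_fset_sum1 -big_fset_condE big_mkcond /=.
  by apply: eq_bigr => b _; rewrite colE.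
rewrite (eq_bigr _ (fun i _ => nE i)) card_fset_sum1.
rewrite exchange_big /=; apply: eq_bigr => b _.
by rewrite -big_mkcond /= (big_pred1 (Ordinal (cd b))) // => i; rewrite eq_sym.
Qed.

Lemma young_diagram_box (D : {fset nat * nat}) (b : nat * nat) :
  young_diagram D -> b \in D -> (b.1 < #|` D|)%N /\ (b.2 < #|` D|)%N.
Proof.
case: b => p q yD bD /=; split.
- pose E := [fset (i, q) | i in iota 0 p.+1]%fset.
  have <- : #|` E| = p.+1.
    rewrite card_imfset /=; last by move=> x y [].
    by rewrite -[LHS]/(size (undup (iota 0 p.+1))) undup_id ?iota_uniq ?size_iota.
  apply: fsubset_leq_card; apply/fsubsetP => x /imfsetP[i].
  rewrite -[X in is_true X -> _]/(i \in iota 0 p.+1) mem_iota => /andP[_ ip] ->.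
  exact: (yD p q).
- pose E := [fset (p, i) | i in iota 0 q.+1]%fset.
  have <- : #|` E| = q.+1.
    rewrite card_imfset /=; last by move=> x y [].
    by rewrite -[LHS]/(size (undup (iota 0 q.+1))) undup_id ?iota_uniq ?size_iota.
  apply: fsubset_leq_card; apply/fsubsetP => x /imfsetP[i].
  rewrite -[X in is_true X -> _]/(i \in iota 0 q.+1) mem_iota => /andP[_ ip] ->.
  exact: (yD p q).
Qed.

Definition square (N : nat) : {fset nat * nat} :=
  [fset b in allpairs pair (iota 0 N) (iota 0 N)]%fset.

Lemma young_diagram_square (N : nat) (D : {fset nat * nat}) :
  young_diagram D -> (#|` D| <= N)%N -> D \in fpowerset (square N).
Proof.
move=> yD DN; rewrite fpowersetE; apply/fsubsetP => -[p q] bD.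
have [/= pD qD] := young_diagram_box yD bD.
rewrite !inE /=; apply/allpairsP; exists (p, q).
by rewrite !mem_iota /= !add0n; split=> //; apply: leq_trans DN.
Qed.

Lemma UCY_set_finite (n d : nat) : (0 < d)%N -> finite_set (UCY_set n d).
Proof.
move=> d0; apply: (@sub_finite_set _ _ [set` fpowerset (square (d * n))]);
  last exact: finite_fset.
move=> D [yD _ nD]; apply: young_diagram_square => //.
by rewrite (card_ncolor _ d0) (eq_bigr _ (fun i _ => nD i)) sum_nat_const card_ord.
Qed.

Lemma CY_set_finite (n d : nat) : finite_set (@CY_set n d).
Proof.
pose P := fpowerset (square n).
apply: (@sub_finite_set _ _
  ((fun t : d.-tuple P => map_tuple val t) @` [set: d.-tuple P])); last first.
  exact/finite_image/finite_finset.
move=> t [yt st].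
have tP k : tnth t k \in P.
  by apply: young_diagram_square (yt k) _; rewrite -st (bigD1 k) //= leq_addr.
exists [tuple [` tP k] | k < d] => //.
by apply: eq_from_tnth => k; rewrite tnth_map tnth_mktuple.
Qed.

(* Main.v *)
Require Import Defs.
From mathcomp Require Import all_boot.
From mathcomp Require Import all_order all_algebra finmap zify.
From mathcomp Require Import boolp classical_sets cardinality.

(* A Young diagram is determined by the numbers a(k) of its boxes of content
   k = p - q.  The sequences that arise are those of finite support whose steps
   a(k) - a(k + 1) lie in {0, 1} for k >= 0 and in {-1, 0} for k < 0.
   Interleaving the step sequences of d diagrams with sequences b_s gives the
   diagram with a(k) = \sum_(s < d) b_s(floor((k + s) / d)); this inverts the
   d-quotient of diagrams with empty d-core.  Summed over any residue class of
   k modulo d, the right-hand side is the total number of boxes of the d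
   diagrams, so the result is uniformly coloured.  Conversely, with
   T(k) = \sum_(j >= 0) a(k + j d), one recovers b_s(m) = T(k) - T(k + 1) for
   k = d m + d - 1 - s; as T(k) is a colour count for k << 0, these b_s have
   finite support exactly when all colour counts agree. *)

Set Implicit Arguments.
Unset Strict Implicit.
Unset Printing Implicit Defensive.

Import Order.TTheory GRing.Theory Num.Theory.

Local Open Scope ring_scope.

(** * Young diagrams through their diagonals *)

Definition content (b : nat * nat) : int := b.1%:Z - b.2%:Z.

Definition diag (D : {fset nat * nat}) (k : int) : nat :=
  #|` [fset b in D | content b == k]%fset|.

Definition tail (d : nat) (D : {fset nat * nat}) (k : int) : nat :=
  #|` [fset b in D | (k <= content b) && (content b == k %[mod d%:Z])%Z]%fset|.

Definition profile (a : int -> nat) : Prop :=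
  [/\ forall k : int, 0 <= k -> (a (k + 1)%R <= a k <= (a (k + 1)%R).+1)%N,
      forall k : int, k < 0 -> (a k <= a (k + 1)%R <= (a k).+1)%N
    & exists N : nat, forall k : int, N%:Z <= `|k| -> a k = 0%N].

(** [minn b.1 b.2] is the position of b on its diagonal, counted from 0 at the border of the
    quadrant. *)
Definition under (a : int -> nat) : set (nat * nat) :=
  [set b | (minn b.1 b.2 < a (content b))%N]%classic.

Definition of_profile (a : int -> nat) : {fset nat * nat} := fset_set (under a).

Definition diag_box (k : int) (i : nat) : nat * nat :=
  if 0 <= k then (i + `|k|, i)%N else (i, i + `|k|)%N.

Lemma content_diag_box k i : content (diag_box k i) = k.
Proof. by rewrite /content /diag_box; case: ifP => /= ?; lia. Qed.

Lemma min_diag_box k i : minn (diag_box k i).1 (diag_box k i).2 = i.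
Proof. by rewrite /diag_box; case: ifP => /= ?; lia. Qed.

Lemma diag_boxK b : diag_box (content b) (minn b.1 b.2) = b.
Proof.
case: b => p q; rewrite /diag_box /content /=.
by case: ifP => ?; congr pair; lia.
Qed.

Lemma content_lt_card D b :
  young_diagram D -> b \in D -> `|content b| < #|` D|%:Z.
Proof. by move=> yD /(young_diagram_box yD); rewrite /content; lia. Qed.

Definition diag_boxes (k : int) (n : nat) : {fset nat * nat} :=
  [fset diag_box k i | i in iota 0 n]%fset.

Lemma mem_diag_boxes k n b :
  (b \in diag_boxes k n) = (content b == k) && (minn b.1 b.2 < n)%N.
Proof.
apply/imfsetP/andP => [[i i_n ->]|[/eqP <- bn]].
- rewrite content_diag_box min_diag_box eqxx.
  by move: i_n; rewrite -[X in is_true X -> _]/(i \in iota 0 n) mem_iota.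
- exists (minn b.1 b.2); last by rewrite diag_boxK.
  by rewrite -[X in is_true X]/(_ \in iota 0 n) mem_iota.
Qed.

Lemma card_diag_boxes k n : #|` diag_boxes k n| = n.
Proof.
rewrite card_imfset /=.
  by rewrite -[LHS]/(size (undup (iota 0 n))) undup_id ?iota_uniq ?size_iota.
by move=> i j /(congr1 (fun c => minn c.1 c.2)); rewrite !min_diag_box.
Qed.

(** Going down a diagonal lowers both coordinates, so D meets each diagonal in an initial
    segment. *)
Lemma mem_young D b :
  young_diagram D -> (b \in D) = (minn b.1 b.2 < diag D (content b))%N.
Proof.
move=> yD; set k := content b; apply/idP/idP => [bD|].
- rewrite -(card_diag_boxes k (minn b.1 b.2).+1).
  apply: fsubset_leq_card; apply/fsubsetP => c.
  rewrite mem_diag_boxes !inE /= => /andP[ck cb]; rewrite ck andbT.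
  case: b c @k bD ck cb => p q [p' q']; rewrite /content /= => bD ck cb.
  by apply: yD bD _ _; lia.
- apply: contraLR => bD; rewrite -leqNgt -[leqRHS](card_diag_boxes k).
  apply: fsubset_leq_card; apply/fsubsetP => c.
  rewrite mem_diag_boxes !inE /= => /andP[cD ck]; rewrite ck /= ltnNge.
  apply: contra bD => bc; case: b c @k ck bc cD => p q [p' q'].
  by rewrite /content /= => ck bc cD; apply: yD cD _ _; lia.
Qed.

Lemma mem_diag_box D k i :
  young_diagram D -> (diag_box k i \in D) = (i < diag D k)%N.
Proof. by move=> yD; rewrite mem_young// content_diag_box min_diag_box. Qed.

Lemma eq_diag D E :
  young_diagram D -> young_diagram E -> diag D =1 diag E -> D = E.
Proof. by move=> yD yE DE; apply/fsetP => b; rewrite !mem_young// DE. Qed.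

Lemma diag0 D (k : int) : young_diagram D -> #|` D|%:Z <= `|k| -> diag D k = 0%N.
Proof.
move=> yD Dk; apply/eqP; rewrite cardfs_eq0; apply/eqP/fsetP => b.
rewrite !inE /=; apply/negP => /andP[/(content_lt_card yD) bD /eqP bk].
by move: bD; rewrite bk; lia.
Qed.

(** Box number [diag D k] is the first one missing from diagonal k. A violated inequality would put
    into D a box that dominates the first missing box of a neighbouring diagonal. *)
Lemma profile_diag D : young_diagram D -> profile (diag D).
Proof.
move=> yD; have stepD k i k' i' : (i < diag D k)%N ->
    ((diag_box k' i').1 <= (diag_box k i).1)%N ->
    ((diag_box k' i').2 <= (diag_box k i).2)%N -> (i' < diag D k')%N.
  rewrite -!mem_diag_box //.
  by case: (diag_box k i) => p q; case: (diag_box k' i') => p' q'; apply: yD.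
split; last by exists #|` D| => k; apply: diag0.
- move=> k k0; rewrite leqNgt [X in _ && X]leqNgt.
  apply/andP; split; apply/negP => h.
  + have := stepD _ _ k (diag D k) h; rewrite /diag_box !ifT //=; lia.
  + have := stepD _ _ (k + 1) (diag D (k + 1)) h; rewrite /diag_box !ifT //=; lia.
- move=> k k0; rewrite leqNgt [X in _ && X]leqNgt.
  apply/andP; split; apply/negP => h.
  + have := stepD _ _ (k + 1) (diag D (k + 1)) h.
    rewrite /diag_box; do 2?case: ifP => /=; lia.
  + have := stepD _ _ k (diag D k) h.
    rewrite /diag_box; do 2?case: ifP => /=; lia.
Qed.

(** * From profiles back to diagrams *)

(** A unit move towards an axis either keeps the position on the diagonal or lowers it by one; the
    bounds in [profile] on each side of k = 0 match these two cases. *)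
Lemma under_down a p q p' q' :
  profile a -> under a (p, q) -> (p' <= p)%N -> (q' <= q)%N -> under a (p', q').
Proof.
move=> [ap an _].
have downl i j : under a (i.+1, j) -> under a (i, j).
  rewrite /under /content /=.
  have -> : i.+1%:Z - j%:Z = (i%:Z - j%:Z) + 1 by lia.
  by have [k0|k0] := lerP 0 (i%:Z - j%:Z); [have := ap _ k0|have := an _ k0]; lia.
have downr i j : under a (i, j.+1) -> under a (i, j).
  rewrite /under /content /=.
  have -> : i%:Z - j%:Z = (i%:Z - j.+1%:Z) + 1 by lia.
  by have [k0|k0] := lerP 0 (i%:Z - j.+1%:Z); [have := ap _ k0|have := an _ k0]; lia.
move=> upq p'p q'q.
have {upq} : under a (p', q).
  by rewrite -(subnK p'p) in upq; elim: (p - p')%N upq => //= k IH /downl.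
by rewrite -(subnK q'q); elim: (q - q')%N => //= k IH /downr.
Qed.

Lemma finite_under a : profile a -> finite_set (under a).
Proof.
move=> pa; have [_ _ [N aN]] := pa.
apply: (@sub_finite_set _ _ [set` square N]); last exact: finite_fset.
have lt_N p q : under a (p, q) -> p = 0%N \/ q = 0%N -> (p < N)%N /\ (q < N)%N.
  move=> + pq; rewrite /under /content /= => u.
  have [/aN|] := lerP N%:Z `|p%:Z - q%:Z|; first by move=> a0; rewrite a0 in u.
  by lia.
move=> [p q] u; rewrite /= !inE /=; apply/allpairsP; exists (p, q).
rewrite !mem_iota /= !add0n; split=> //.
(* The boxes (p, 0) and (0, q) also lie in the region, and their contents are p and - q. *)
- by have [] := lt_N p 0%N (under_down pa u (leqnn p) (leq0n q)) (or_intror erefl).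
- by have [] := lt_N 0%N q (under_down pa u (leq0n p) (leqnn q)) (or_introl erefl).
Qed.

Lemma mem_of_profile a b :
  profile a -> (b \in of_profile a) = (minn b.1 b.2 < a (content b))%N.
Proof.
move=> pa; rewrite in_fset_set; last exact: finite_under.
by apply/idP/idP => [/set_mem|/mem_set].
Qed.

Lemma young_of_profile a : profile a -> young_diagram (of_profile a).
Proof.
move=> pa p q p' q'; rewrite !mem_of_profile//; exact: under_down.
Qed.

Lemma diag_of_profile a : profile a -> diag (of_profile a) =1 a.
Proof.
move=> pa k; have memE i : (i < diag (of_profile a) k)%N = (i < a k)%N.
  rewrite -mem_diag_box; last exact: young_of_profile.
  by rewrite mem_of_profile // content_diag_box min_diag_box.
by apply/eqP; rewrite eqn_leq leqNgt memE ltnn leqNgt -memE ltnn.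
Qed.

(** * Tail sums along residue classes *)

Lemma tail_step d D (k : int) : (0 < d)%N ->
  tail d D k = (diag D k + tail d D (k + d%:Z)%R)%N.
Proof.
move=> d0; rewrite /tail /diag !card_fset_sum1 -!big_fset_condE /=.
rewrite big_mkcond [X in (X + _)%N]big_mkcond [X in (_ + X)%N]big_mkcond /=.
rewrite -big_split /=; apply: eq_bigr => b _.
rewrite modzDr.
have [->|bk] := eqVneq (content b) k.
  by rewrite lexx eqxx ifF //; lia.
rewrite add0n; case: eqP => [/eqP|]; last by rewrite !andbF.
rewrite !andbT eqz_mod_dvd => /dvdzP[q bkq].
(* Here [content b - k] is q d with q nonzero, so both inequalities say q > 0. *)
have -> // : (k <= content b) = (k + d%:Z <= content b).
have [q1|q1] := lerP 1 q.
  by have : d%:Z <= q * d%:Z; [rewrite ler_peMl|]; lia.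
have q_neg : q * d%:Z <= - d%:Z; last by lia.
  rewrite -mulN1r ler_pM2r //; suff : q != 0 by lia.
  by apply: contraNneq bk => q0; rewrite -subr_eq0 bkq q0 mul0r.
Qed.

Lemma tail0 d D (k : int) : young_diagram D -> #|` D|%:Z <= k -> tail d D k = 0%N.
Proof.
move=> yD Dk; apply/eqP; rewrite cardfs_eq0; apply/eqP/fsetP => b.
rewrite !inE /=; apply/negP => /and3P[/(content_lt_card yD) bD bk _].
by lia.
Qed.

Lemma tail_ncolor d D (k : int) (i : nat) : young_diagram D -> k <= - #|` D|%:Z ->
  (k == i%:Z %[mod d%:Z])%Z -> tail d D k = ncolor d i D.
Proof.
move=> yD Dk /eqP ki; congr #|` _|; apply/fsetP => b; rewrite !inE /=.
rewrite ki; have [bD|//] := boolP (b \in D).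
by rewrite (_ : k <= content b); last by have := content_lt_card yD bD; lia.
Qed.

Lemma ncolor1 D : ncolor 1 0 D = #|` D|.
Proof. by rewrite (@card_ncolor 1) // big_ord1. Qed.

Lemma tail1_card D (k : int) :
  young_diagram D -> k <= - #|` D|%:Z -> tail 1 D k = #|` D|.
Proof.
by move=> yD Dk; rewrite -(ncolor1 D); apply: tail_ncolor; rewrite ?modz1.
Qed.

(** Descending induction in strides of d; the equality of differences is written additively because
    subtraction in [nat] truncates. *)
Lemma eq_from_steps (d : nat) (f g : int -> nat) (N : int) :
  (0 < d)%N ->
  (forall k, f k + g (k + d%:Z)%R = f (k + d%:Z)%R + g k)%N ->
  (forall k, N <= k -> f k = 0%N) -> (forall k, N <= k -> g k = 0%N) -> f =1 g.
Proof.
move=> d0 fg fN gN k.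
have [n] : exists n : nat, N - k <= n%:Z
      by exists `|N - k|%N; lia.
elim: n k => [|n IH] k kn; first by rewrite fN ?gN //; lia.
have := fg k; rewrite (IH (k + d%:Z)); lia.
Qed.

(** * Interleaving d profiles *)

Definition interleave (d : nat) (b : 'I_d -> int -> nat) (k : int) : nat :=
  \sum_(s < d) b s ((k + (s : nat)%:Z) %/ d%:Z)%Z.

(** The k for which floor((k + s) / d) is m and rises to m + 1 at k + 1. *)
Definition slot (d : nat) (s : 'I_d) (m : int) : int :=
  m * d%:Z + (d%:Z - 1 - (s : nat)%:Z).

Lemma slotP d (k : int) : (0 < d)%N -> exists s m, k = @slot d s m.
Proof.
move=> d0; set r := (k %% d%:Z)%Z.
have r0 : 0 <= r by apply: modz_ge0; lia.
have rd : r < d%:Z by apply: ltz_pmod.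
have sd : (d.-1 - `|r| < d)%N by lia.
exists (Ordinal sd), (k %/ d%:Z)%Z; rewrite {1}(divz_eq k d%:Z) /slot -/r /=; lia.
Qed.

Lemma slot_ge0 d (s : 'I_d) m : (0 <= slot s m) = (0 <= m).
Proof.
rewrite /slot; have sd := ltn_ord s.
have [m0|m0] := lerP 0 m.
  by have : 0 <= m * d%:Z; [apply: mulr_ge0|]; lia.
suff : m * d%:Z <= - d%:Z by lia.
by rewrite -mulN1r ler_pM2r; lia.
Qed.

Lemma slotS d (s : 'I_d) m : slot s (m + 1) = slot s m + d%:Z.
Proof. by rewrite /slot; lia. Qed.

Lemma norm_slot d (s : 'I_d) m : `|m| <= `|slot s m| + 1.
Proof.
have sd := ltn_ord s; have := slot_ge0 s m.
have [m0|m0] := lerP 0 m; rewrite /slot => h.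
  by have : m <= m * d%:Z; [rewrite ler_peMr|]; lia.
have : (- m - 1) <= (- m - 1) * d%:Z; [rewrite ler_peMr|]; lia.
Qed.

(** Compared with [divz_slotS], only s' = s distinguishes [s < s'] from [s <= s']: a single summand
    of [interleave] moves at each step. *)
Lemma divz_slot d (s s' : 'I_d) m :
  ((slot s m + (s' : nat)%:Z) %/ d%:Z)%Z = m + (s < s')%N%:Z.
Proof.
have := ltn_ord s; have := ltn_ord s'; rewrite /slot -addrA => s'd sd.
rewrite divzMDl; last by lia.
congr (_ + _); case: ltnP => ss'.
  have -> : d%:Z - 1 - (s : nat)%:Z + (s' : nat)%:Z =
            1 * d%:Z + (s' - s - 1)%N%:Z by lia.
  by rewrite divzMDl ?divz_small; lia.
by rewrite divz_small; lia.
Qed.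

Lemma divz_slotS d (s s' : 'I_d) m :
  ((slot s m + 1 + (s' : nat)%:Z) %/ d%:Z)%Z = m + (s <= s')%N%:Z.
Proof.
have := ltn_ord s; have := ltn_ord s'; rewrite /slot -!addrA => s'd sd.
rewrite divzMDl; last by lia.
congr (_ + _); case: leqP => ss'.
  have -> : d%:Z + (- 1 + (- (s : nat)%:Z + (1 + (s' : nat)%:Z))) =
            1 * d%:Z + (s' - s)%N%:Z by lia.
  by rewrite divzMDl ?divz_small; lia.
by rewrite divz_small; lia.
Qed.

Lemma interleave_step d (b : 'I_d -> int -> nat) s m :
  (interleave b (slot s m) + b s (m + 1)%R =
   interleave b (slot s m + 1)%R + b s m)%N.
Proof.
rewrite /interleave (bigD1 s) //= [in RHS](bigD1 s) //=.
rewrite divz_slot divz_slotS leqnn ltnn addr0.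
rewrite [in RHS](eq_bigr (fun s' => b s' ((slot s m + (s' : nat)%:Z) %/ d%:Z)%Z)).
  by set x := bigop _ _ _; set y := b s (m + 1); rewrite -/y; lia.
by move=> s' ss'; rewrite divz_slot divz_slotS ltn_neqAle eq_sym ss'.
Qed.

Lemma profile_interleave d (b : 'I_d -> int -> nat) :
  (0 < d)%N -> (forall s, profile (b s)) -> profile (interleave b).
Proof.
move=> d0 pb; split.
- move=> k; have [s [m ->]] := slotP k d0; rewrite slot_ge0 => m0.
  have [/(_ m m0) + _ _] := pb s; have := interleave_step b s m; lia.
- move=> k; have [s [m ->]] := slotP k d0; rewrite ltNge slot_ge0 -ltNge => m0.
  have [_ /(_ m m0) + _] := pb s; have := interleave_step b s m; lia.
have /choice[N NP] s : exists n : nat, forall k : int, n%:Z <= `|k| -> b s k = 0%N.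
  by have [] := pb s.
(* The quotient q of k + s by d satisfies |k - q d| < d, so this bound on |k| forces |q| past every
   [N s]. *)
exists ((\max_s N s).+1 * d)%N => k kN; apply: big1 => s _; apply: NP.
have := leq_bigmax s (F := N); set M := (\max_s N s)%N in kN *; move=> NM.
have sd := ltn_ord s; set q := (_ %/ _)%Z.
have := divz_eq (k + (s : nat)%:Z) d%:Z; rewrite -/q.
have r0 := modz_ge0 (k + (s : nat)%:Z) (d := d%:Z).
have rd := ltz_pmod (k + (s : nat)%:Z) (d := d%:Z).
move: r0 rd; set r := (_ %% _)%Z => r0 rd qE.
suff : M%:Z <= `|q| by lia.
have [//|qM] := lerP M%:Z `|q|.
have : `|q * d%:Z| <= (M%:Z - 1) * d%:Z by rewrite normrM ler_pM2r; lia.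
lia.
Qed.

(** * Assembling a tuple into one diagram *)

Definition assemble d (t : d.-tuple {fset nat * nat}) : {fset nat * nat} :=
  of_profile (interleave (fun s => diag (tnth t s))).

Lemma profile_assemble d (t : d.-tuple {fset nat * nat}) :
  (0 < d)%N ->
  (forall s, young_diagram (tnth t s)) ->
  profile (interleave (fun s => diag (tnth t s))).
Proof. by move=> d0 yt; apply: profile_interleave => // s; apply: profile_diag. Qed.

Lemma young_assemble d (t : d.-tuple {fset nat * nat}) :
  (0 < d)%N -> (forall s, young_diagram (tnth t s)) -> young_diagram (assemble t).
Proof. by move=> d0 yt; apply/young_of_profile/profile_assemble. Qed.

Lemma divzDd (d : nat) (k s : int) :
  (0 < d)%N ->
  ((k + d%:Z + s) %/ d%:Z)%Z = (((k + s) %/ d%:Z)%Z + 1)%R.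
Proof.
move=> d0; rewrite addrAC addrC -[d%:Z in X in (X %/ _)%Z]mul1r.
by rewrite divzMDl 1?addrC //; lia.
Qed.

(** Replacing k by k + d raises every quotient by 1, so both sides drop by [interleave] at k; both
    vanish for large k. *)
Lemma tail_assemble d (t : d.-tuple {fset nat * nat}) (k : int) :
  (0 < d)%N ->
  (forall s, young_diagram (tnth t s)) ->
  tail d (assemble t) k =
  (\sum_(s < d) tail 1 (tnth t s) ((k + (s : nat)%:Z) %/ d%:Z)%Z)%N.
Proof.
move=> d0 yt; have yD := young_assemble d0 yt.
set M := (\sum_(s < d) #|` tnth t s|)%N.
pose g k := (\sum_(s < d) tail 1 (tnth t s) ((k + (s : nat)%:Z) %/ d%:Z)%Z)%N.
move: k; apply: (@eq_from_steps d _ g (#|` assemble t| + M * d)%N%:Z) => // k.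
- rewrite tail_step // diag_of_profile; last exact: profile_assemble.
  rewrite -addnA [RHS]addnC -/(g k) addnC -addnA [RHS]addnC; congr addn.
  rewrite /g /interleave -big_split /=; apply: eq_bigr => s _.
  by rewrite [RHS]tail_step // divzDd // addnC.
- by move=> kN; apply: tail0 => //; lia.
- move=> kN; apply: big1 => s _; apply: tail0 => //.
  have sM : (#|` tnth t s| <= M)%N by rewrite /M (bigD1 s) //= leq_addr.
  apply: (@le_trans _ _ M%:Z); first by rewrite lez_nat.
  by rewrite lez_divRL ?ltz_nat //; lia.
Qed.

Lemma ncolor_assemble d (t : d.-tuple {fset nat * nat}) (i : nat) :
  (0 < d)%N ->
  (forall s, young_diagram (tnth t s)) ->
  ncolor d i (assemble t) = (\sum_(s < d) #|` tnth t s|)%N.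
Proof.
move=> d0 yt; have yD := young_assemble d0 yt.
set M := (\sum_(s < d) #|` tnth t s|)%N.
(* This k is congruent to i and so far left that the tails on both sides of [tail_assemble] count
   all boxes of their class. *)
pose k : int := i%:Z - (#|` assemble t| + M + i + 1)%N%:Z * d%:Z.
have kd : k <= - (#|` assemble t|)%:Z - (M.+1)%:Z * d%:Z by rewrite /k; nia.
rewrite -(tail_ncolor (k := k)) //; first last.
- by rewrite /k -mulNr addrC modzMDl.
- lia.
rewrite tail_assemble //; apply: eq_bigr => s _; rewrite tail1_card //.
have sM : (#|` tnth t s| <= M)%N by rewrite /M (bigD1 s) //= leq_addr.
apply: (@le_trans _ _ (- M%:Z)); last by lia.
rewrite -ltzD1 ltz_divLR ?ltz_nat //; have := ltn_ord s; lia.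
Qed.

(** The step of the interleaving at [slot s m] is the step of the s-th diagonal counts at m, and
    finite support recovers the counts from their steps. *)
Lemma assemble_inj d (t t' : d.-tuple {fset nat * nat}) :
  (0 < d)%N ->
  (forall s, young_diagram (tnth t s)) -> (forall s, young_diagram (tnth t' s)) ->
  assemble t = assemble t' -> t = t'.
Proof.
move=> d0 yt yt' tt'; apply: eq_from_tnth => s; apply: eq_diag => // m.
have E (k : int) : interleave (fun s => diag (tnth t s)) k =
           interleave (fun s => diag (tnth t' s)) k.
  rewrite -(diag_of_profile (profile_assemble d0 yt)).
  by rewrite -(diag_of_profile (profile_assemble d0 yt')) -!/(assemble _) tt'.
move: m; apply: (@eq_from_steps 1 _ _ (#|` tnth t s| + #|` tnth t' s|)%N%:Z) => // m.
- have := interleave_step (fun s => diag (tnth t s)) s m.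
  have := interleave_step (fun s => diag (tnth t' s)) s m.
  rewrite /= !E -[1%:Z]/(1 : int); lia.
- by move=> ?; apply: diag0 => //; lia.
- by move=> ?; apply: diag0 => //; lia.
Qed.

(** * Splitting a uniformly coloured diagram *)

Lemma assemble_surj d D (n : nat) :
  (0 < d)%N -> young_diagram D -> (forall i : 'I_d, ncolor d i D = n) ->
  exists2 t : d.-tuple {fset nat * nat},
    (forall s, young_diagram (tnth t s)) & assemble t = D.
Proof.
move=> d0 yD nD.
have tailn (k : int) : k <= - (#|` D|)%:Z -> tail d D k = n.
  move=> kD; have rd : (`|(k %% d%:Z)%Z| < d)%N.
    have := modz_ge0 k (d := d%:Z); have := ltz_pmod k (d := d%:Z); lia.
  rewrite -(nD (Ordinal rd)); apply: tail_ncolor => //=.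
  by rewrite gez0_abs ?modz_mod //; apply: modz_ge0; lia.
pose B (k : int) : nat := (tail d D k - tail d D (k + 1)%R)%N.
have [ap an _] := profile_diag yD.
(* Makes the subtraction in [B] exact. For k >= 0 the induction starts at the far right, where tails
   vanish; for k < 0 at the far left, where all tails equal n by uniform colouring. *)
have le_tail (k : int) : (tail d D (k + 1)%R <= tail d D k)%N.
  have [k0|k0] := lerP 0 k.
  - have [N] : exists N : nat, (#|` D|)%:Z - k <= N%:Z
      by exists `|(#|` D|)%:Z - k|%N; lia.
    elim: N k k0 => [|N IH] k k0 kN; first by rewrite !tail0 //; lia.
    rewrite tail_step // [X in (_ <= X)%N]tail_step //.
    have /andP[ak _] := ap k k0; apply: leq_add ak _.
    by rewrite addrAC; apply: IH; lia.
  - have [N] : exists N : nat, (#|` D|)%:Z + k < N%:Z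
      by exists `|((#|` D|)%:Z + k + 1)%R|%N; lia.
    elim: N k k0 => [|N IH] k k0 kN; first by rewrite !tailn //; lia.
    have [p kp] : exists p, k = p + d%:Z by exists (k - d%:Z); rewrite subrK.
    have {}IH : (tail d D (p + 1)%R <= tail d D p)%N by apply: IH; lia.
    have /an/andP[ap' _] : p < 0 by lia.
    rewrite kp addrAC -(leq_add2l (diag D p)).
    move: IH; rewrite (tail_step D p d0) (tail_step D (p + 1) d0).
    by apply: leq_trans; rewrite leq_add2r.
(* A stride of d in [B] has the same difference as a unit step in [diag D]. *)
have BE (k : int) : (diag D k + B (k + d%:Z)%R = diag D (k + 1)%R + B k)%N.
  have := le_tail k; have := le_tail (k + d%:Z); rewrite /B.
  rewrite [tail d D k]tail_step // [tail d D (k + 1)]tail_step //.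
  have -> : k + 1 + d%:Z = k + d%:Z + 1 by rewrite addrAC.
  by lia.
pose b (s : 'I_d) (m : int) := B (slot s m).
have pb s : profile (b s).
  split=> [m|m|].
  - rewrite -(slot_ge0 s) => /ap; have := BE (slot s m); rewrite /b slotS; lia.
  - rewrite ltNge -(slot_ge0 s) -ltNge => /an.
    have := BE (slot s m); rewrite /b slotS; lia.
  (* One unit is lost in [norm_slot], the other covers the shift from k to k + 1 in [B]. *)
  - exists (#|` D|.+2)%N => m mN; have := norm_slot s m; rewrite /b /B.
    have [m0|m0] := lerP 0 (slot s m) => h.
    + by rewrite !tail0 //; lia.
    + by rewrite !tailn //; lia.
pose t := [tuple of_profile (b s) | s < d].
have tE s : tnth t s = of_profile (b s) by rewrite tnth_mktuple.
have yt s : young_diagram (tnth t s) by rewrite tE; apply: young_of_profile.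
exists t => //; apply: eq_diag => //; first exact: young_assemble.
apply: (@eq_from_steps 1 _ _ (#|` assemble t| + #|` D|)%N%:Z) => // k.
- have [s [m ->]] := slotP k d0; rewrite -[1%:Z]/(1 : int).
  rewrite !diag_of_profile; [|exact: profile_assemble..].
  have := interleave_step (fun s => diag (tnth t s)) s m.
  rewrite /= !tE !diag_of_profile // /b slotS; have := BE (slot s m); lia.
- by move=> ?; apply: diag0; [exact: young_assemble|lia].
- by move=> ?; apply: diag0 => //; lia.
Qed.

(** * Counting through the bijection *)

Theorem theorem3 (n d : nat) (hn : (0 < n)%N) (hd : (0 < d)%N) :
  UCY n d = CY n d.
Proof.
rewrite /UCY /CY.
have -> : UCY_set n d = (@assemble d @` @CY_set n d)%classic.
  apply/seteqP; split=> D.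
  - move=> [yD _ nD]; have [t yt tD] := assemble_surj hd yD nD.
    exists t => //; split=> //.
    (* Any colour gives the total size of t; colour 0 exists since d > 0. *)
    by rewrite -(ncolor_assemble 0 hd yt) tD (nD (Ordinal hd)).
  - move=> [t [yt tn] <-]; split; first exact: young_assemble.
      by move=> i j; rewrite !ncolor_assemble.
    by move=> i; rewrite ncolor_assemble.
rewrite fset_set_image; last exact: CY_set_finite.
apply: card_in_imfset => t t' /=.
rewrite !in_fset_set; try exact: CY_set_finite.
by move=> /set_mem[yt _] /set_mem[yt' _]; apply: assemble_inj.
Qed.
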